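(* Let $F$ be an isoparametric polynomial of degree $g$ on $\mathbb{R}^{n+2}$ with $g\geqslant 2$, let $\Phi=\frac1g\nabla F:\mathbb{R}^{n+2}\to\mathbb{R}^{n+2}$ be its gradient map, and for $s\in[-1,1]$ let $M_s=\{p\in S^{n+1}: F(p)=s\}$. Then for every $\tau\in\mathbb{R}$, $$\Phi\big(M_{\cos(g\tau)}\big)=M_{\cos(g(1-g)\tau)}.$$ In particular: (i) $\Phi$ maps each focal submanifold $M_1$, $M_{-1}$ onto a focal submanifold (i.e. $\Phi(M_{1}),\Phi(M_{-1})\in\{M_1,M_{-1}\}$); (ii) if $s\in\mathcal{D}=\{\cos\frac{k\pi}{g-1}: k\in\mathbb{Z},\ 1\leqslant k<g-1\}$, then $\Phi$ maps the isoparametric hypersurface $M_s$ onto a focal submanifold (i.e. $\Phi(M_s)\in\{M_1,M_{-1}\}$); (iii) if $s\in(-1,1)\setminus\mathcal{D}$, then $\Phi$ maps the isoparametric hypersurface $M_s$ onto an isoparametric hypersurface (i.e. $\Phi(M_s)=M_{s'}$ for some $s'\in(-1,1)$). In particular, $\Phi$ provides a homogeneous polynomial automorphism on a certain isoparametric hypersurface: there exists $s\in(-1,1)$ such that $\Phi(M_s)=M_s$ and $\Phi|_{M_s}:M_s\to M_s$ is a diffeomorphism.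
   Context: Isoparametric hypersurface: a connected oriented hypersurface $M$ of the unit sphere $S^{n+1}\subset\mathbb{R}^{n+2}$ (with oriented unit normal field $\xi$) whose principal curvatures are constant; $g$ denotes the number of distinct principal curvatures. Write them as $\lambda_i=\cot\theta_i$ with $\lambda_1>\cdots>\lambda_g$, $0<\theta_1<\dots<\theta_g<\pi$, where the principal curvatures are the eigenvalues of the shape operator $X\mapsto -D_X\xi$. It is well known that $\theta_i=\theta_1+\frac{i-1}{g}\pi$. Isoparametric polynomial of $M$: let $\phi(x,t)=\cos t\cdot x+\sin t\cdot\xi_x$ for $x\in M$, $t\in\mathbb{R}$. Near a regular point of $\phi$, $\phi$ is a diffeomorphism of a neighbourhood $U$ onto an open set $V\subset S^{n+1}$; put $\tau(p)=\theta_1-t$ for $p=\phi(x,t)\in V$ and $F(rp)=r^g\cos(g\tau(p))$ for $r>0$, $p\in V$. It is well known (Münzner) that this function is the restriction of a homogeneous polynomial $F$ of degree $g$ on $\mathbb{R}^{n+2}$, uniquely determined by $M$, called the isoparametric polynomial of $M$. It satisfies the Cartan–Münzner equations $$|\nabla F|^2=g^2|x|^{2g-2},\qquad \Delta F=\tfrac{g^2}{2}(m_2-m_1)|x|^{g-2},$$ where $m_1$, $m_2$ are the multiplicities of the maximal and the minimal principal curvature of $M$. An isoparametric polynomial on $\mathbb{R}^{n+2}$ is a polynomial arising in this way from some connected oriented isoparametric hypersurface in $S^{n+1}$. Well-known facts fixing terminology: $F|_{S^{n+1}}$ has range $[-1,1]$; for $s\in(-1,1)$ the level set $M_s$ is a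 compact connected isoparametric hypersurface (all of these being parallel to $M$), while $M_1$ and $M_{-1}$ are submanifolds of $S^{n+1}$, called the focal submanifolds, of codimension $m_1+1$ and $m_2+1$ respectively. The map $\Phi$ has components that are homogeneous polynomials of degree $g-1$ and maps $S^{n+1}$ into $S^{n+1}$. For $g=2$ the set $\mathcal{D}$ is empty. *)

(* Defs.v *)
From HB Require Import structures.
From mathcomp Require Import all_boot all_order all_algebra.
(* The notations of mpoly clash with those of analysis. *)
From mathcomp Require Import -(notations) mpoly.
From mathcomp Require Import all_classical all_reals all_analysis.

Set Implicit Arguments.
Unset Strict Implicit.
Unset Printing Implicit Defensive.

Import Order.TTheory GRing.Theory Num.Theory numFieldNormedType.Exports.

Local Open Scope classical_set_scope.
Local Open Scope ring_scope.

Section Smooth.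
Context {R : realType} {V W : normedModType R}.

(* Class C^k on an open set O.  The recursion goes through all directional
   derivatives, which gives the usual notion when V is finite-dimensional, the
   only case used below. *)
Fixpoint Ck_on (k : nat) (O : set V) (f : V -> W) : Prop :=
  match k with
  | 0 => forall x, O x -> {for x, continuous f}
  | k'.+1 => (forall x, O x -> differentiable f x) /\
             (forall v, Ck_on k' O ('D_v f))
  end.

(* Smoothness of a map on an arbitrary subset A of V: near each point of A, the
   map is the restriction to A of a C^oo map defined on an open set of V. *)
Definition smooth_map (A : set V) (f : V -> W) : Prop :=
  forall x, A x -> exists O : set V, exists h : V -> W,
    [/\ open O, O x, (forall k, Ck_on k O h) &
        forall y, A y -> O y -> h y = f y].

Definition relatively_open (A U : set V) : Prop :=
  exists2 O, open O & U = A `&` O.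

End Smooth.

Definition diffeo {R : realType} {V W : normedModType R}
    (A : set V) (B : set W) (f : V -> W) : Prop :=
  [/\ set_bij A B f, smooth_map A f &
      exists2 h : W -> V, forall x, A x -> h (f x) = x & smooth_map B h].

Section Submanifold.
Context {R : realType} {V : normedModType R}.

(* Embedded submanifold of dimension k, given by local parametrizations. *)
Definition submanifold (k : nat) (M : set V) : Prop :=
  forall x, M x -> exists U : set V, exists O : set 'rV[R]_k,
    exists f : 'rV[R]_k -> V,
      [/\ relatively_open M U, U x, open O & diffeo O U f].

Definition curve_in (M : set V) (x X : V) (c : R -> V) : Prop :=
  [/\ c 0 = x, (\forall t \near (0 : R), M (c t)) &
      is_derive (0 : R) (1 : R) c X].

Definition tangent_space (M : set V) (x : V) : set V :=
  [set X | exists c, curve_in M x X c].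

(* D_X f for X tangent to M at x and f defined on M: the derivative of f along
   any curve of M with velocity X at x. *)
Definition tangent_derive {W : normedModType R} (M : set V) (f : V -> W)
    (x X : V) : W :=
  get [set Y | exists2 c, curve_in M x X c & is_derive (0 : R) (1 : R) (f \o c) Y].

End Submanifold.

Section Isoparametric.
Context {R : realType}.

(* The norm of the normed module 'rV[R]_m is the sup norm, hence the explicit
   Euclidean inner product; the two norms define the same topology. *)
Definition dot (m : nat) (u v : 'rV[R]_m) : R := \sum_(i < m) u 0 i * v 0 i.

Definition sphere (m : nat) : set 'rV[R]_m := [set x | dot x x = 1].

Definition cot (t : R) : R := cos t / sin t.

(* The values of xi outside M are irrelevant. *)
Definition oriented_hypersurface (n : nat) (M : set 'rV[R]_n.+2)
    (xi : 'rV[R]_n.+2 -> 'rV[R]_n.+2) : Prop :=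
  [/\ M `<=` @sphere n.+2, submanifold n M, smooth_map M xi &
      forall x, M x -> [/\ dot (xi x) (xi x) = 1, dot (xi x) x = 0 &
        forall X, tangent_space M x X -> dot (xi x) X = 0]].

Definition shape_operator (n : nat) (M : set 'rV[R]_n.+2)
    (xi : 'rV[R]_n.+2 -> 'rV[R]_n.+2) (x X : 'rV[R]_n.+2) : 'rV[R]_n.+2 :=
  - tangent_derive M xi x X.

Definition principal_curvature (n : nat) (M : set 'rV[R]_n.+2)
    (xi : 'rV[R]_n.+2 -> 'rV[R]_n.+2) (x : 'rV[R]_n.+2) (l : R) : Prop :=
  exists X, [/\ tangent_space M x X, X != 0 & shape_operator M xi x X = l *: X].

(* [theta] lists the angles theta_1 < ... < theta_g, with g = size theta. *)
Definition isoparametric_hypersurface (n : nat) (M : set 'rV[R]_n.+2)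
    (xi : 'rV[R]_n.+2 -> 'rV[R]_n.+2) (theta : seq R) : Prop :=
  [/\ M !=set0, connected M, oriented_hypersurface M xi,
      sorted <%R theta && all (fun t => 0 < t < pi) theta &
      forall x, M x -> forall l, principal_curvature M xi x l <->
        exists2 t, t \in theta & l = cot t].

Definition parallel_map (n : nat) (xi : 'rV[R]_n.+2 -> 'rV[R]_n.+2)
    (p : 'rV[R]_n.+2 * R) : 'rV[R]_n.+2 :=
  cos p.2 *: p.1 + sin p.2 *: xi p.1.

Definition peval (m : nat) (F : mpoly.mpoly m R) (x : 'rV[R]_m) : R :=
  mpoly.meval (fun i => x 0 i) F.

(* F is the polynomial extending F(r p) = r^g cos(g tau(p)), p in V, r > 0, where
   tau(phi(x, t)) = theta_1 - t and phi, the parallel map, is a diffeomorphism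
   from a neighbourhood U of some point of M x R (necessarily a regular point of
   phi) onto an open set V of the sphere. *)
Definition isoparametric_polynomial_of (n : nat) (M : set 'rV[R]_n.+2)
    (xi : 'rV[R]_n.+2 -> 'rV[R]_n.+2) (theta : seq R)
    (F : mpoly.mpoly n.+2 R) : Prop :=
  let g := size theta in
  F \is mpoly.ishomog1 g mpoly.mdeg /\
  exists U : set ('rV[R]_n.+2 * R), exists V : set 'rV[R]_n.+2,
    [/\ U !=set0, relatively_open (M `*` [set: R]) U,
        relatively_open (@sphere n.+2) V, diffeo U V (parallel_map xi) &
        forall x t r, U (x, t) -> 0 < r ->
          peval F (r *: parallel_map xi (x, t))
          = r ^+ g * cos (g%:R * (head 0 theta - t))].

Definition isoparametric_polynomial (n g : nat) (F : mpoly.mpoly n.+2 R) : Prop :=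
  exists M xi theta,
    [/\ size theta = g, isoparametric_hypersurface M xi theta &
        isoparametric_polynomial_of M xi theta F].

Definition gradient (m : nat) (F : mpoly.mpoly m R) (x : 'rV[R]_m) : 'rV[R]_m :=
  \row_i peval (mpoly.mderiv i F) x.

Definition gradient_map (m g : nat) (F : mpoly.mpoly m R) (x : 'rV[R]_m) :
    'rV[R]_m :=
  g%:R^-1 *: gradient F x.

Definition level_set (m : nat) (F : mpoly.mpoly m R) (s : R) : set 'rV[R]_m :=
  [set p | sphere p /\ peval F p = s].

Definition exceptional_values (g : nat) : set R :=
  [set s | exists2 k : nat, (1 <= k < g.-1)%N & s = cos (k%:R * pi / (g%:R - 1))].

End Isoparametric.

(* Main.v *)
Require Import Defs.
From HB Require Import structures.
From mathcomp Require Import all_boot all_order all_algebra.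
From mathcomp Require Import -(notations) mpoly.
From mathcomp Require Import all_classical all_reals all_analysis.
From mathcomp Require Import ring lra.
Import Order.TTheory GRing.Theory Num.Theory numFieldNormedType.Exports.
Local Open Scope classical_set_scope.
Local Open Scope ring_scope.

(* Let N be the unit normal, at p = phi(x, t), of the parallel hypersurface through
   p.  Since F = cos(g tau) on V, the gradient map is Phi(p) = cos(g tau) p +
   sin(g tau) N, and F(cos u p + sin u N) = cos(g (tau - u)).  Cleared of
   denominators and square roots, both facts become polynomial identities in p that
   hold on the open cone over V, hence everywhere: |Phi(x)|^2 = |x|^(2g-2), and a
   formula for F along the line x + s (|x|^2 Phi(x) - F(x) x).  So each q in the
   sphere with F(q) = cos(g sigma) and sin(g sigma) <> 0 has a unit N orthogonal to
   q with F(cos u q + sin u N) = cos(g (sigma - u)); compactness gives such an N at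
   the focal points as well, these being limits of regular points.  As |Phi| = 1 on
   the sphere, this forces Phi to rotate the circle by the angle g (sigma - u), and
   both inclusions of the main equality are read off this rotation.  On M_s with
   s = cos(2 pi / g) (g >= 3), Phi has the polynomial inverse 2 s q - Phi(q); for
   g = 2 it is an involution of M_0. *)

Set Implicit Arguments.
Unset Strict Implicit.
Unset Printing Implicit Defensive.

(** * Functions polynomial along lines and the identity principle *)

Section LinePoly.
Context {R : realType}.

(** Constants and variables generate the polynomials as a ring: a monomial is a product of powers of
    variables. Induction in this form fits properties of evaluation, which pass to sums and
    products. *)
Lemma mpoly_alg_ind (m : nat) (P : mpoly.mpoly m R -> Prop) :
  (forall c, P (mpolyC m c)) -> (forall i, P (mpolyX R (mnm1 i))) ->
  (forall p q, P p -> P q -> P (p + q)) ->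
  (forall p q, P p -> P q -> P (p * q)) -> forall p, P p.
Proof.
move=> PC PX PD PM.
have PX' mm : P (mpolyX R mm).
  rewrite mpolyXE_id; elim/big_ind : _ => //; first exact: PC 1.
  move=> i _; elim: (mm i) => [|k IH]; first exact: PC 1.
  by rewrite exprS; exact: PM.
apply: mpolyind => [|c mm p _ _ Pp]; first by rewrite -mpolyC0.
by apply: PD => //; rewrite -mul_mpolyC; exact: PM.
Qed.

(* Being polynomial along every line suffices for the identity principle, and is
   stable under substitution without composing mpolys. *)
Definition line_poly (m : nat) (f : 'rV[R]_m -> R) : Prop :=
  forall a v, exists p : {poly R}, forall s, f (a + s *: v) = p.[s].

Lemma line_polyC (m : nat) (c : R) : line_poly (fun _ : 'rV[R]_m => c).
Proof. by move=> a v; exists c%:P => s; rewrite hornerC. Qed.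

Lemma line_polyD (m : nat) (f1 f2 : 'rV[R]_m -> R) :
  line_poly f1 -> line_poly f2 -> line_poly (fun x => f1 x + f2 x).
Proof.
move=> h1 h2 a v; have [p hp] := h1 a v; have [q hq] := h2 a v.
by exists (p + q) => s; rewrite hp hq hornerD.
Qed.

Lemma line_polyM (m : nat) (f1 f2 : 'rV[R]_m -> R) :
  line_poly f1 -> line_poly f2 -> line_poly (fun x => f1 x * f2 x).
Proof.
move=> h1 h2 a v; have [p hp] := h1 a v; have [q hq] := h2 a v.
by exists (p * q) => s; rewrite hp hq hornerM.
Qed.

Lemma line_polyN (m : nat) (f : 'rV[R]_m -> R) :
  line_poly f -> line_poly (fun x => - f x).
Proof.
by move=> h a v; have [p hp] := h a v; exists (- p) => s; rewrite hp hornerN.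
Qed.

Lemma line_polyX (m k : nat) (f : 'rV[R]_m -> R) :
  line_poly f -> line_poly (fun x => f x ^+ k).
Proof.
by move=> h a v; have [p hp] := h a v; exists (p ^+ k) => s; rewrite hp horner_exp.
Qed.

Lemma line_poly_sum (m k : nat) (f : 'I_k -> 'rV[R]_m -> R) :
  (forall i, line_poly (f i)) -> line_poly (fun x => \sum_(i < k) f i x).
Proof.
move=> h a v; exists (\sum_(i < k) sval (cid (h i a v))) => s.
by rewrite horner_sum; apply: eq_bigr => i _; case: cid.
Qed.

Lemma line_poly_coord (m : nat) (i : 'I_m) : line_poly (fun x : 'rV[R]_m => x 0 i).
Proof.
by move=> a v; exists ((a 0 i)%:P + (v 0 i)%:P * 'X) => s; rewrite !hornerE !mxE mulrC.
Qed.

Lemma pevalC (m : nat) (c : R) (x : 'rV[R]_m) : peval (mpolyC m c) x = c.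
Proof. by rewrite /peval mevalC. Qed.

Lemma pevalX (m : nat) (i : 'I_m) (x : 'rV[R]_m) :
  peval (mpolyX R (mnm1 i)) x = x 0 i.
Proof. by rewrite /peval mevalXU. Qed.

Lemma pevalD (m : nat) (p q : mpoly.mpoly m R) (x : 'rV[R]_m) :
  peval (p + q) x = peval p x + peval q x.
Proof. by rewrite /peval mevalD. Qed.

Lemma pevalM (m : nat) (p q : mpoly.mpoly m R) (x : 'rV[R]_m) :
  peval (p * q) x = peval p x * peval q x.
Proof. by rewrite /peval mevalM. Qed.

Definition pevalE := (pevalC, pevalX, pevalD, pevalM).

Lemma line_poly_peval (m k : nat) (G : mpoly.mpoly k R) (f : 'rV[R]_m -> 'rV[R]_k) :
  (forall i, line_poly (fun x => f x 0 i)) -> line_poly (fun x => peval G (f x)).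
Proof.
move=> hf; elim/mpoly_alg_ind: G => [c|i|p q hp hq|p q hp hq] a v.
- by have [r hr] := line_polyC c a v; exists r => s; rewrite -hr pevalE.
- by have [r hr] := hf i a v; exists r => s; rewrite -hr pevalE.
- by have [r hr] := line_polyD hp hq a v; exists r => s; rewrite -hr pevalE.
- by have [r hr] := line_polyM hp hq a v; exists r => s; rewrite -hr pevalE.
Qed.

Lemma poly_near_eq0 (p : {poly R}) (a : R) :
  (\forall s \near a, p.[s] = 0) -> p = 0.
Proof.
move=> /nbhs_ballP[e /= e0 he].
(* These are [size p] distinct roots, more than the degree allows. The shift to [k.+2] makes every
   offset strictly smaller than the radius [e]. *)
pose rs := [seq a + e / (k.+2)%:R | k <- iota 0 (size p)].
apply: (@roots_geq_poly_eq0 _ p rs); last by rewrite size_map size_iota.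
- apply/allP => _ /mapP[k _ ->]; apply/eqP; apply: he.
  rewrite /ball/= opprD addNKr normrN gtr0_norm ?divr_gt0 ?ltr0n//.
  by rewrite ltr_pdivrMr ?ltr0n// ltr_pMr// ltr1n.
- rewrite map_inj_uniq ?iota_uniq// => i j /addrI.
  move/(mulfI (lt0r_neq0 e0))/invr_inj/eqP; rewrite eqr_nat.
  by move=> /eqP[].
Qed.

(** On the line from [a] (at parameter 0) to [x] (at parameter 1), [f] is a polynomial vanishing
    near 0, hence the zero polynomial. *)
Lemma line_poly_eq0 (m : nat) (f : 'rV[R]_m -> R) (a : 'rV[R]_m) :
  line_poly f -> (\forall x \near a, f x = 0) -> forall x, f x = 0.
Proof.
move=> hf h0 x; have [p hp] := hf a (x - a).
suff p0 : p = 0 by rewrite -(subrKC a x) -[x - a]scale1r hp p0 horner0.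
apply: (@poly_near_eq0 _ 0).
have c : (fun s : R => a + s *: (x - a)) @ (0 : R) --> a.
  rewrite -[X in _ --> X](addr0 a) -(scale0r (x - a)).
  apply: cvgD; first exact: cvg_cst.
  by apply: cvgZr_tmp; exact: cvg_id.
have h1 := c _ h0; near=> s; rewrite -hp; near: s; exact: h1.
Unshelve. all: by end_near. Qed.

End LinePoly.

(** * The Euclidean inner product, continuity, and open cones *)

Section Dot.
Context {R : realType} {m : nat}.
Implicit Types u v w : 'rV[R]_m.

Lemma dotC u v : dot u v = dot v u.
Proof. by apply: eq_bigr => i _; rewrite mulrC. Qed.

Lemma dotDl u v w : dot (u + v) w = dot u w + dot v w.
Proof. by rewrite -big_split; apply: eq_bigr => i _; rewrite /= mxE mulrDl. Qed.

Lemma dotZl (a : R) u v : dot (a *: u) v = a * dot u v.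
Proof. by rewrite mulr_sumr; apply: eq_bigr => i _; rewrite mxE mulrA. Qed.

Lemma dotNl u v : dot (- u) v = - dot u v.
Proof. by rewrite -scaleN1r dotZl mulN1r. Qed.

Lemma dotDr u v w : dot w (u + v) = dot w u + dot w v.
Proof. by rewrite dotC dotDl !(dotC w). Qed.

Lemma dotZr (a : R) u v : dot v (a *: u) = a * dot v u.
Proof. by rewrite dotC dotZl dotC. Qed.

Lemma dotNr u v : dot v (- u) = - dot v u.
Proof. by rewrite dotC dotNl dotC. Qed.

Definition dotE := (dotDl, dotDr, dotZl, dotZr, dotNl, dotNr).

Lemma dot_ge0 u : 0 <= dot u u.
Proof. by apply: sumr_ge0 => i _; rewrite -expr2 sqr_ge0. Qed.

Lemma dot_eq0 u : dot u u = 0 -> u = 0.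
Proof.
move=> /eqP; rewrite psumr_eq0; last by move=> i _; rewrite -expr2 sqr_ge0.
by move=> /allP h; apply/rowP => i; rewrite mxE; apply/eqP;
  rewrite -[_ == _]orbb -mulf_eq0; apply: h; rewrite mem_index_enum.
Qed.

Lemma line_poly_dot (k : nat) (f1 f2 : 'rV[R]_k -> 'rV[R]_m) :
  (forall i, line_poly (fun x => f1 x 0 i)) ->
  (forall i, line_poly (fun x => f2 x 0 i)) -> line_poly (fun x => dot (f1 x) (f2 x)).
Proof. by move=> h1 h2; apply: line_poly_sum => i; apply: line_polyM. Qed.

Lemma continuous_peval (F : mpoly.mpoly m R) : continuous (peval F).
Proof.
move: F; apply: (@mpoly_alg_ind R m (fun G => continuous (peval G)))
  => [c|i|p q hp hq|p q hp hq] x.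
- rewrite (_ : peval _ = cst c); first exact: cst_continuous.
  by apply/funext => y; rewrite pevalE.
- rewrite (_ : peval _ = fun y => y 0 i); first exact: coord_continuous.
  by apply/funext => y; rewrite pevalE.
- rewrite (_ : peval _ = peval p + peval q); first
    by apply: continuousD; [exact: hp|exact: hq].
  by apply/funext => y; rewrite pevalE.
- rewrite (_ : peval _ = peval p * peval q); first
    by apply: continuousM; [exact: hp|exact: hq].
  by apply/funext => y; rewrite pevalE.
Qed.

Lemma continuous_dot (T : topologicalType) (f1 f2 : T -> 'rV[R]_m) (x : T) :
  {for x, continuous f1} -> {for x, continuous f2} ->
  {for x, continuous (fun y => dot (f1 y) (f2 y))}.
Proof.
move=> h1 h2.
have h i : {for x, continuous (fun y => f1 y 0 i * f2 y 0 i)}.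
  apply: continuousM.
  - exact: (continuous_comp h1 (@coord_continuous _ _ _ 0 i _)).
  - exact: (continuous_comp h2 (@coord_continuous _ _ _ 0 i _)).
rewrite (_ : (fun _ => _) = \sum_(i < m) (fun y => f1 y 0 i * f2 y 0 i)); last first.
  by apply/funext => y; rewrite fct_sumE.
elim/big_ind: _ => [|f g hf hg|i _]; last exact: h.
- exact: cst_continuous.
- exact: continuousD.
Qed.

(** The radial projection y / |y| is continuous at [p] and fixes it, so it sends points near [p]
    into [V]. *)
Lemma cone_nbhs (V : set 'rV[R]_m) (p : 'rV[R]_m) :
  relatively_open (@sphere R m) V -> V p ->
  \forall y \near p, exists r, exists2 q, 0 < r & V q /\ y = r *: q.
Proof.
move=> [W oO ->] [Sp Op].
have dc x : {for x, continuous (fun y : 'rV[R]_m => dot y y)}.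
  by apply: continuous_dot; exact: cvg_id.
have nc : {for p, continuous (fun y : 'rV[R]_m => (Num.sqrt (dot y y))^-1 *: y)}.
  apply: continuousZ; last exact: cvg_id.
  apply: continuousV; first by rewrite Sp sqrtr1 oner_neq0.
  exact: (continuous_comp (dc p) (@sqrt_continuous R _)).
have On : \forall y \near p, W ((Num.sqrt (dot y y))^-1 *: y).
  apply: (nc W); rewrite /= Sp sqrtr1 invr1 scale1r; exact: open_nbhs_nbhs.
have dn : \forall y \near p, 0 < dot y y.
  apply: (dc p [set x | 0 < x]); rewrite /= Sp; apply: open_nbhs_nbhs.
  by split; [exact: open_gt|exact: ltr01].
near=> y; have y0 : 0 < dot y y by near: y.
have s0 : 0 < Num.sqrt (dot y y) by rewrite sqrtr_gt0.
exists (Num.sqrt (dot y y)), ((Num.sqrt (dot y y))^-1 *: y) => //.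
split; last by rewrite scalerA mulfV ?scale1r// gt_eqF.
split; last by near: y.
rewrite /sphere/= dotZl dotZr mulrA -invfM -expr2 sqr_sqrtr ?dot_ge0//.
by rewrite mulVf// gt_eqF.
Unshelve. all: by end_near. Qed.

End Dot.

(** * Directional derivatives of coordinates, polynomials and products *)

Section Derivatives.
Context {R : realType} {V : normedModType R}.
Implicit Types (x v : V).

Lemma is_derive_rV (m : nat) (c : V -> 'rV[R]_m) x v (X : 'rV[R]_m) :
  is_derive x v c X <-> forall i, is_derive x v (fun y => c y 0 i) (X 0 i).
Proof.
split=> [[dc <-] i|h].
  split; first by move/derivable_mxP : dc.
  by rewrite derive_mx// mxE.
have dc : derivable c x v.
  by apply/derivable_mxP => i j; rewrite (ord1 i); case: (h j).
split=> //; rewrite derive_mx//; apply/rowP => i; rewrite mxE.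
by case: (h i).
Qed.

Lemma is_derive_peval (m : nat) (F : mpoly.mpoly m R) (c : V -> 'rV[R]_m) x v
    (X : 'rV[R]_m) :
  is_derive x v c X ->
  is_derive x v (fun y => peval F (c y)) (dot (gradient F (c x)) X).
Proof.
move=> /is_derive_rV hc; move: F.
apply: (@mpoly_alg_ind R m (fun F => is_derive x v (fun y => peval F (c y))
  (dot (gradient F (c x)) X))) => [a|i|p q hp hq|p q hp hq].
- rewrite (_ : (fun _ => _) = cst a); last by apply/funext => y; rewrite pevalE.
  apply: is_derive_eq; rewrite /dot big1// => i _.
  by rewrite mxE mderivC /peval meval0 mul0r.
- rewrite (_ : (fun _ => _) = fun y => c y 0 i); last first.
    by apply/funext => y; rewrite pevalE.
  apply: is_derive_eq; rewrite /dot (bigD1 i)//= big1 => [|j ji].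
    rewrite mxE mderivX mnm1E eqxx scale1r (_ : mnm_sub _ _ = mnm0).
      by rewrite /peval mpolyX0 meval1 mul1r addr0.
    by apply/mnmP => k; rewrite mnmBE subnn mnm0E.
  by rewrite mxE mderivX mnm1E eq_sym (negbTE ji) scale0r /peval meval0 mul0r.
- rewrite (_ : (fun _ => _) = (fun y => peval p (c y)) + (fun y => peval q (c y)));
    last by apply/funext => y; rewrite pevalE.
  apply: is_derive_eq; rewrite -dotDl; congr dot; apply/rowP => i.
  by rewrite !mxE mderivD pevalE.
- rewrite (_ : (fun _ => _) = (fun y => peval p (c y)) * (fun y => peval q (c y)));
    last by apply/funext => y; rewrite pevalE.
  have Z (a b : R) : a *: b = a * b by [].
  apply: is_derive_eq; rewrite 2!Z -2!dotZl -dotDl; congr dot; apply/rowP => i.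
  by rewrite !mxE mderivM !pevalE addrC [in LHS]mulrC.
Qed.

Lemma is_derive_dot (m : nat) (c d : V -> 'rV[R]_m) x v (X Y : 'rV[R]_m) :
  is_derive x v c X -> is_derive x v d Y ->
  is_derive x v (fun y => dot (c y) (d y)) (dot X (d x) + dot (c x) Y).
Proof.
move=> /is_derive_rV hc /is_derive_rV hd.
rewrite (_ : (fun _ => _) =
  \sum_(i < m) ((fun y => c y 0 i) * (fun y => d y 0 i))); last first.
  by apply/funext => y; rewrite fct_sumE.
apply: is_derive_eq; rewrite -big_split; apply: eq_bigr => i _ /=.
by rewrite addrC; congr (_ + _); rewrite -[LHS]/(_ * _) mulrC.
Qed.

Lemma is_derive_scale (m : nat) (f : V -> R) (c : V -> 'rV[R]_m) x v (f' : R)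
    (X : 'rV[R]_m) :
  is_derive x v f f' -> is_derive x v c X ->
  is_derive x v (fun y => f y *: c y) (f' *: c x + f x *: X).
Proof.
move=> hf /is_derive_rV hc; apply/is_derive_rV => i.
rewrite (_ : (fun _ => _) = f * (fun y => c y 0 i)); last first.
  by apply/funext => y; rewrite mxE.
apply: is_derive_eq; rewrite !mxE addrC; congr (_ + _).
by rewrite -[LHS]/(_ * _) mulrC.
Qed.

Lemma is_derive_comp (W : normedModType R) (c : R -> V) (X : V) (f : V -> W) :
  differentiable f (c 0) -> is_derive (0 : R) (1 : R) c X ->
  is_derive (0 : R) (1 : R) (f \o c) ('d f (c 0) X).
Proof.
move=> df [dc <-].
have dc' : differentiable c 0 by apply/derivable1_diffP.
have dfc : differentiable (f \o c) 0 by exact: differentiable_comp.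
split; first exact/derivable1_diffP.
by rewrite (deriveE _ dfc) (deriveE _ dc') diff_comp.
Qed.

End Derivatives.

(** * Smoothness of polynomial maps *)

Section PolynomialMaps.
Context {R : realType} {m k : nat}.
Implicit Type G : 'I_k -> mpoly.mpoly m R.

Definition poly_map G (x : 'rV[R]_m) : 'rV[R]_k := \row_i peval (G i) x.

Lemma differentiable_peval (F : mpoly.mpoly m R) (x : 'rV[R]_m) :
  differentiable (peval F) x.
Proof.
move: F; apply: (@mpoly_alg_ind R m (fun F => differentiable (peval F) x))
  => [a|i|p q hp hq|p q hp hq].
- rewrite (_ : peval _ = cst a); first exact: differentiable_cst.
  by apply/funext => y; rewrite pevalE.
- rewrite (_ : peval _ = fun y => y 0 i); first exact: differentiable_coord.
  by apply/funext => y; rewrite pevalE.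
- rewrite (_ : peval _ = peval p + peval q); first exact: differentiableD.
  by apply/funext => y; rewrite pevalE.
- rewrite (_ : peval _ = peval p * peval q); first exact: differentiableM.
  by apply/funext => y; rewrite pevalE.
Qed.

Lemma differentiable_poly_map G (x : 'rV[R]_m) : differentiable (poly_map G) x.
Proof.
rewrite (_ : poly_map G = \sum_(i < k) (fun y => peval (G i) y *: delta_mx 0 i)).
  by apply: differentiable_sum => i; apply: differentiableZl; exact: differentiable_peval.
apply/funext => y; rewrite fct_sumE [LHS]row_sum_delta.
by apply: eq_bigr => i _; rewrite mxE.
Qed.

(** A directional derivative of a polynomial map is again a polynomial map, which is what drives the
    induction on the class C^k. *)
Lemma derive_poly_map G (v : 'rV[R]_m) :
  'D_v (poly_map G) = poly_map (fun i => \sum_(j < m) v 0 j *: mderiv j (G i)).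
Proof.
apply/funext => x; suff /@derive_val : is_derive x v (poly_map G)
  (poly_map (fun i => \sum_(j < m) v 0 j *: mderiv j (G i)) x) by [].
apply/is_derive_rV => i.
rewrite (_ : (fun _ => _) = fun y => peval (G i) y); last by apply/funext => y; rewrite mxE.
apply: (is_derive_eq (is_derive_peval (G i) (is_derive_id x v))).
rewrite mxE /peval raddf_sum; apply: eq_bigr => j _.
by rewrite /= mxE mevalZ mulrC.
Qed.

Lemma Ck_poly_map (r : nat) (O : set 'rV[R]_m) G : Ck_on r O (poly_map G).
Proof.
elim: r G => [|r IH] G /=.
  by move=> x _; apply: differentiable_continuous; exact: differentiable_poly_map.
split=> [x _|v]; first exact: differentiable_poly_map.
by rewrite derive_poly_map.
Qed.

Lemma smooth_poly_map (A : set 'rV[R]_m) G : smooth_map A (poly_map G).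
Proof.
move=> x _; exists setT, (poly_map G); split => //; first exact: openT.
by move=> r; exact: Ck_poly_map.
Qed.

End PolynomialMaps.

(** * Homogeneous polynomials and great circles *)

Section CalculusOnSphere.
Context {R : realType}.

Lemma is_derive_unique (V W : normedModType R) (f h : V -> W) (a v : V) (d e : W) :
  (\forall x \near a, f x = h x) -> is_derive a v f d -> is_derive a v h e -> d = e.
Proof.
move=> fh fd he; have hd := near_eq_is_derive fh fd.
by rewrite -(@derive_val _ _ _ _ _ _ _ hd) (@derive_val _ _ _ _ _ _ _ he).
Qed.

Lemma is_derive_inj (V W : normedModType R) (f : V -> W) (a v : V) (d e : W) :
  is_derive a v f d -> is_derive a v f e -> d = e.
Proof. by apply: is_derive_unique; near=> x. Unshelve. all: by end_near. Qed.

Lemma is_derive_cosM (f : R -> R) (k c d a : R) :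
  is_derive a (1 : R) f d ->
  is_derive a (1 : R) (fun x => cos (k * (c - f x))) (k * sin (k * (c - f a)) * d).
Proof.
move=> fd.
have h : is_derive a (1 : R) (fun x => k * (c - f x)) (- (k * d)).
  rewrite (_ : (fun _ => _) = k *: (cst c - f))//.
  by apply: is_derive_eq; rewrite sub0r scalerN.
apply: (is_derive_eq (is_derive1_comp (is_derive_cos _) h)) => /=.
by rewrite mulrNN mulrCA mulrA.
Qed.

Lemma peval_homog (m d : nat) (F : mpoly.mpoly m R) (r : R) (x : 'rV[R]_m) :
  F \is mpoly.ishomog1 d mpoly.mdeg -> peval F (r *: x) = r ^+ d * peval F x.
Proof.
move=> /dhomog_mf hF; rewrite /peval !mevalE mulr_sumr big_seq [RHS]big_seq.
apply: eq_bigr => mm /hF hmm; rewrite mulrCA; congr (_ * _).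
under eq_bigr do rewrite mxE exprMn; rewrite big_split /=; congr (_ * _).
by have <- : mdeg mm = d by []; rewrite mdegE expr_sum.
Qed.

Lemma dot_delta (m : nat) (u : 'rV[R]_m) (i : 'I_m) : dot u (delta_mx 0 i) = u 0 i.
Proof.
rewrite /dot (bigD1 i)//= big1 => [|j /negbTE ji]; rewrite !mxE ?eqxx ?ji /=.
  by rewrite mulr1 addr0.
by rewrite mulr0.
Qed.

(** Differentiate y -> F(r y) by the chain rule and by homogeneity, then cancel one factor [r]. *)
Lemma gradient_homog (m d : nat) (F : mpoly.mpoly m R) (r : R) (x : 'rV[R]_m) :
  F \is mpoly.ishomog1 d.+1 mpoly.mdeg -> r != 0 ->
  gradient F (r *: x) = r ^+ d *: gradient F x.
Proof.
move=> hF r0; apply/rowP => i; set v : 'rV[R]_m := delta_mx 0 i.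
have d1 : is_derive x v (fun y => peval F (r *: y)) (dot (gradient F (r *: x)) (r *: v)).
  apply: is_derive_peval; exact: (is_deriveZ r (is_derive_id x v)).
have d2 : is_derive x v (fun y => peval F (r *: y)) (r ^+ d.+1 * dot (gradient F x) v).
  rewrite (_ : (fun _ => _) = r ^+ d.+1 *: (fun y => peval F y)).
    exact: (is_deriveZ _ (is_derive_peval F (is_derive_id x v))).
  by apply/funext => y; rewrite (peval_homog _ _ hF).
have := is_derive_inj d1 d2.
by rewrite dotZr !dot_delta exprS -mulrA => /(mulfI r0) ->; rewrite [RHS]mxE.
Qed.

(** Euler's relation, from the two ways of differentiating s -> F(s x) at s = 1. *)
Lemma euler_homog (m d : nat) (F : mpoly.mpoly m R) (x : 'rV[R]_m) :
  F \is mpoly.ishomog1 d mpoly.mdeg -> dot (gradient F x) x = d%:R * peval F x.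
Proof.
move=> hF.
have d0 : is_derive (1 : R) (1 : R) (fun s : R => s *: x) x.
  have h1 := is_derive_id (1 : R) (1 : R).
  have h2 := @is_derive_cst R R _ x 1 1.
  apply: (is_derive_eq (is_derive_scale h1 h2)).
  by rewrite scaler0 addr0 scale1r.
have d1 := is_derive_peval F d0.
have d2 : is_derive (1 : R) (1 : R) (fun s : R => peval F (s *: x)) (d%:R * peval F x).
  rewrite (_ : (fun _ => _) = peval F x *: (id ^+ d)).
    apply: is_derive_eq; rewrite expr1n mulr1.
    by rewrite -[LHS]/(_ * (_ * _)) mulr1 mulrC.
  by apply/funext => y; rewrite (peval_homog _ _ hF) fctE mulrC.
by have := is_derive_inj d1 d2; rewrite scale1r.
Qed.

(** For orthonormal [p], [N] this is the unit-speed great circle leaving [p] with velocity [N]; its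
    velocity at [s] is [circle N (- p) s]. *)
Definition circle (m : nat) (p N : 'rV[R]_m) (s : R) : 'rV[R]_m :=
  cos s *: p + sin s *: N.

Definition orthonormal (m : nat) (p N : 'rV[R]_m) : Prop :=
  [/\ dot p p = 1, dot N N = 1 & dot p N = 0].

Lemma circle_sphere (m : nat) (p N : 'rV[R]_m) (s : R) :
  orthonormal p N -> dot (circle p N s) (circle p N s) = 1.
Proof.
move=> [pp NN pN]; rewrite /circle !dotE pp NN (dotC N) pN.
by apply: etrans (cos2Dsin2 s); ring.
Qed.

Lemma orthonormal_rot (m : nat) (x N : 'rV[R]_m) (t : R) :
  orthonormal x N -> orthonormal (circle x N t) (circle N (- x) t).
Proof.
move=> [xx nn xn]; rewrite /orthonormal /circle !dotE xx nn (dotC N) xn.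
by split; [apply: etrans (cos2Dsin2 t)|apply: etrans (cos2Dsin2 t)|]; ring.
Qed.

Lemma circle_rot (m : nat) (x N : 'rV[R]_m) (t u : R) :
  circle (circle x N t) (circle N (- x) t) u = circle x N (t + u).
Proof.
rewrite /circle cosD sinD; apply/rowP => i; rewrite !mxE; ring.
Qed.

Lemma is_derive_circle (m : nat) (p N : 'rV[R]_m) (s : R) :
  is_derive s (1 : R) (circle p N) (circle N (- p) s).
Proof.
have h1 := is_derive_scale (is_derive_cos s) (is_derive_cst p s 1).
have h2 := is_derive_scale (is_derive_sin s) (is_derive_cst N s 1).
apply: (is_derive_eq (is_deriveD h1 h2)).
by rewrite !scaler0 !addr0 /circle scaleNr scalerN addrC.
Qed.

Lemma continuous_circle (m : nat) (p N : 'rV[R]_m) : continuous (circle p N).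
Proof.
move=> s; apply: differentiable_continuous; apply/derivable1_diffP.
by case: (is_derive_circle p N s).
Qed.

End CalculusOnSphere.

(** * The gradient map on the open set swept out by parallel hypersurfaces *)

Section LocalStructure.
Context {R : realType} {n : nat}.
Implicit Types (M : set 'rV[R]_n.+2) (xi : 'rV[R]_n.+2 -> 'rV[R]_n.+2).

(* Differentiating c = cos t x + sin t xi(x) along a curve and pairing with the unit
   normal N = - sin t x + cos t xi(x) of the parallel hypersurface isolates t'. *)
Lemma dot_normal_velocity (x X xi0 Y : 'rV[R]_n.+2) (t T : R) :
  orthonormal x xi0 -> dot x X = 0 -> dot xi0 X = 0 -> dot x Y = 0 -> dot xi0 Y = 0 ->
  dot (T *: circle xi0 (- x) t + (cos t *: X + sin t *: Y)) (circle xi0 (- x) t) = T.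
Proof.
move=> [xx nn xn] h1 h2 h3 h4; rewrite /circle !dotE (dotC X x) (dotC X xi0).
rewrite (dotC Y x) (dotC Y xi0) h1 h2 h3 h4 xx nn (dotC xi0) xn.
apply: etrans (_ : T * (cos t ^+ 2 + sin t ^+ 2) = _); first by ring.
by rewrite cos2Dsin2 mulr1.
Qed.

(** The difference D = v - w is orthogonal to [p]; were it nonzero, testing against X = D / |D|
    would give |D| = 0. *)
Lemma orthonormal_eq (p v w : 'rV[R]_n.+2) : dot p p = 1 -> dot v p = dot w p ->
  (forall X, orthonormal p X -> dot v X = dot w X) -> v = w.
Proof.
move=> pp vwp h; apply/eqP; rewrite -subr_eq0; apply/eqP; set D := v - w.
have Dp : dot p D = 0 by rewrite dotC dotDl dotNl vwp subrr.
have [//|D0] := eqVneq D 0.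
have DD : 0 < dot D D.
  rewrite lt_neqAle dot_ge0 andbT eq_sym; apply: contra_neq D0; exact: dot_eq0.
have s0 : 0 < Num.sqrt (dot D D) by rewrite sqrtr_gt0.
have /h : orthonormal p ((Num.sqrt (dot D D))^-1 *: D).
  split => //; last by rewrite dotZr Dp mulr0.
  by rewrite dotZl dotZr mulrA -invfM -expr2 sqr_sqrtr ?(ltW DD)// mulVf// gt_eqF.
rewrite !dotZr => /(mulfI (invr_neq0 (lt0r_neq0 s0))) /eqP.
by rewrite -subr_eq0 -dotNl -dotDl -/D (gt_eqF DD).
Qed.

Lemma differentiable_fst (V W : normedModType R) (x : V * W) :
  differentiable (@fst V W) x.
Proof.
by apply: (@linear_differentiable _ _ _ (@fst V W)) => z; exact: cvg_fst.
Qed.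

Lemma differentiable_snd (V W : normedModType R) (x : V * W) :
  differentiable (@snd V W) x.
Proof.
by apply: (@linear_differentiable _ _ _ (@snd V W)) => z; exact: cvg_snd.
Qed.

Lemma near_cst_derive (f : R -> R) (k d : R) :
  (\forall s \near (0 : R), f s = k) -> is_derive (0 : R) (1 : R) f d -> d = 0.
Proof. by move=> fk fd; 
  exact: (@is_derive_unique _ _ _ f (cst k) _ _ _ _ fk fd (is_derive_cst _ _ _)). Qed.

(** On V the value of F depends only on the parallel parameter t. The radial part of the gradient
    comes from Euler's relation, the tangential part from differentiating F along great circles,
    where only the speed of t enters. *)
Lemma local_structure M xi theta (F : mpoly.mpoly n.+2 R) (g := size theta) :
  oriented_hypersurface M xi -> isoparametric_polynomial_of M xi theta F ->
  (0 < g)%N ->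
  exists V, [/\ V !=set0, relatively_open (@sphere R n.+2) V &
    forall p, V p -> exists tau N, [/\ orthonormal p N,
      gradient_map g F p = cos (g%:R * tau) *: p + sin (g%:R * tau) *: N &
      \forall u \near (0 : R), forall r, 0 < r ->
        peval F (r *: circle p N u) = r ^+ g * cos (g%:R * (tau - u))]].
Proof.
move=> [MS _ xis Mxi] [hF [U [V [[y0 Uy0] Uo Vo [bij _ [h hK hs]] hU]]]] g0.
have gR : (g%:R : R) != 0 by rewrite pnatr_eq0 -lt0n.
case: (Uo) => OU oOU UE; case: (Vo) => OV oOV VE.
exists V; split => //; first by exists (parallel_map xi y0); case: bij => + _ _; apply.
move=> p Vp; have [_ _ /(_ p Vp) [[x t] Uxt fxt]] := bij.
have Mx : M x by move: Uxt; rewrite UE => -[[]].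
have [nn nx tn] := Mxi x Mx.
have on : orthonormal x (xi x) by split; rewrite // ?[dot x (xi x)]dotC//; exact: MS.
have pE : p = circle x (xi x) t by rewrite -fxt.
exists (head 0 theta - t), (circle (xi x) (- x) t).
set N := circle (xi x) (- x) t; set tau := _ - t.
have pN : orthonormal p N by rewrite pE; exact: orthonormal_rot.
split => //; last first.
  (* Only the parameter t moves while x stays in [M], so relative openness of [U] keeps the pair in
     [U] for small u. *)
  have c : {for (0 : R), continuous (fun u : R => (x, t + u))}.
    have c1 : (fun=> x) @ (0 : R) --> x by exact: cvg_cst.
    have c2 : (fun u : R => t + u) @ (0 : R) --> t + 0.
      by apply: cvgD; [exact: cvg_cst|exact: cvg_id].
    exact: (cvg_pair c1 c2).
  have cO : \forall u \near (0 : R), OU (x, t + u).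
    apply: (c OU); rewrite /= addr0; apply: open_nbhs_nbhs; split => //.
    by move: Uxt; rewrite UE => -[].
  near=> u => r r0; rewrite pE circle_rot -/(parallel_map xi (x, t + u)) hU//.
    by rewrite opprD addrA.
  by rewrite UE; split => //; near: u.
have Fp : peval F p = cos (g%:R * tau).
  by rewrite -fxt -[parallel_map _ _]scale1r hU// expr1n mul1r.
have pp : dot p p = 1 by case: pN.
(* It suffices to compare the inner products with [p] (Euler) and with each unit vector X orthogonal
   to [p]. *)
apply: (orthonormal_eq pp).
  rewrite dotZl (euler_homog _ hF) Fp mulrA mulVf// mul1r dotDl !dotZl pp.
  by case: pN => _ _; rewrite dotC => ->; rewrite mulr1 mulr0 addr0.
move=> X pX; have [_ XX pX0] := pX.
rewrite dotZl dotDl !dotZl pX0 mulr0 add0r.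
pose c := circle p X.
have c0 : c 0 = p by rewrite /c /circle cos0 sin0 scale1r scale0r addr0.
have dc : is_derive (0 : R) (1 : R) c X.
  by apply: (is_derive_eq (is_derive_circle p X 0)); rewrite /circle cos0 sin0
    scale1r scale0r addr0.
(* A smooth local extension of the inverse of the parallel map lifts the great circle [c] to a
   differentiable curve ([xs], [ts]) in M x R. *)
have [Oh [h' [oOh Oph ck hh']]] := hs p Vp.
have dh : differentiable h' (c 0) by rewrite c0; exact: (ck 1%N).1.
have dhc : differentiable (h' \o c) 0.
  by apply: differentiable_comp => //; apply/derivable1_diffP; case: dc.
pose xs s := (h' (c s)).1; pose ts s := (h' (c s)).2.
have h'p : h' p = (x, t) by rewrite hh'// -fxt hK.
have xs0 : xs 0 = x by rewrite /xs c0 h'p.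
have ts0 : ts 0 = t by rewrite /ts c0 h'p.
have dxs : differentiable xs 0.
  apply: (@differentiable_comp _ _ _ _ (h' \o c) fst) => //.
  exact: differentiable_fst.
have dts : differentiable ts 0.
  apply: (@differentiable_comp _ _ _ _ (h' \o c) snd) => //.
  exact: differentiable_snd.
have /derivableP := (derivable1_diffP _ _).2 dxs; set X1 := 'D_1 xs 0 => Dxs.
have /derivableP := (derivable1_diffP _ _).2 dts; set T1 := 'D_1 ts 0 => Dts.
have nV : \forall s \near (0 : R), V (c s) /\ Oh (c s).
  have cc : {for (0 : R), continuous c} by exact: continuous_circle.
  have n1 : \forall s \near (0 : R), OV (c s).
    apply: (cc OV); rewrite c0; apply: open_nbhs_nbhs; split => //.
    by move: Vp; rewrite VE => -[].
  have n2 : \forall s \near (0 : R), Oh (c s).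
    by apply: (cc Oh); rewrite c0; exact: open_nbhs_nbhs.
  near=> s; split; last by near: s.
  by rewrite VE; split; [exact: circle_sphere|near: s].
have nU : \forall s \near (0 : R),
    U (xs s, ts s) /\ c s = parallel_map xi (xs s, ts s).
  apply: filterS nV => s [Vcs Ohc]; have [_ _ /(_ _ Vcs) [y Uy fy]] := bij.
  by rewrite /xs /ts hh'// -surjective_pairing -fy hK.
have nM : \forall s \near (0 : R), M (xs s).
  by apply: filterS nU => s [+ _]; rewrite UE => -[[]].
have tX1 : dot (xi x) X1 = 0 by apply: tn; exists xs; split.
(* Since [xi] is meaningful only on [M], it is differentiated along [xs] through a smooth extension
   [xi'] that agrees with it there. *)
have [Ox [xi' [oOx Oxx ckx hxi']]] := xis x Mx.
have dxi' : differentiable xi' (xs 0) by rewrite xs0; exact: (ckx 1%N).1.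
have dxi : is_derive (0 : R) (1 : R) (xi' \o xs) ('d xi' (xs 0) X1).
  exact: is_derive_comp.
move: ('d xi' (xs 0) X1) dxi => Y dxi.
have xi'x : xi' (xs 0) = xi x by rewrite xs0 hxi'.
have nxi : \forall s \near (0 : R), xi' (xs s) = xi (xs s).
  have cx : {for (0 : R), continuous xs} by exact: differentiable_continuous.
  have n1 : \forall s \near (0 : R), Ox (xs s).
    by apply: (cx Ox); rewrite xs0; exact: open_nbhs_nbhs.
  by apply: filterS2 nM n1 => s; exact: hxi'.
(* This and the next two orthogonality relations come from differentiating the constants |x|^2 = 1,
   |xi|^2 = 1 and x . xi = 0 along the curve. *)
have xX1 : dot x X1 = 0.
  have := near_cst_derive _ (is_derive_dot Dxs Dxs); rewrite xs0 (dotC X1).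
  move=> /(_ 1) h2; have : dot x X1 + dot x X1 = 0.
    by apply: h2; apply: filterS nM => s; exact: MS.
  lra.
have nY : dot (xi x) Y = 0.
  have := near_cst_derive _ (is_derive_dot dxi dxi); rewrite /= xi'x (dotC Y).
  move=> /(_ 1) h2; have : dot (xi x) Y + dot (xi x) Y = 0.
    by apply: h2; apply: filterS2 nM nxi => s /Mxi[? _ _] ->.
  lra.
have xY : dot x Y = 0.
  have := @near_cst_derive _ 0 _ _ (is_derive_dot Dxs dxi).
  rewrite /= xi'x xs0 (dotC X1) tX1 add0r; apply.
  by apply: filterS2 nM nxi => s /Mxi[_ ? _] ->; rewrite dotC.
have XE : X = T1 *: N + (cos t *: X1 + sin t *: Y).
  have D1 := is_deriveD
    (is_derive_scale (is_derive1_comp (is_derive_cos (ts 0)) Dts) Dxs)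
    (is_derive_scale (is_derive1_comp (is_derive_sin (ts 0)) Dts) dxi).
  have nc : \forall s \near (0 : R), c s =
    ((fun y => (cos \o ts) y *: xs y) + (fun y => (sin \o ts) y *: (xi' \o xs) y)) s.
    by apply: filterS2 nU nxi => s [_ ->] e; rewrite /parallel_map /= -e.
  rewrite (is_derive_unique nc dc D1) /= xi'x xs0 ts0 /N /circle.
  by apply/rowP => i; rewrite !mxE; ring.
have T1E : dot X N = T1 by rewrite XE; exact: dot_normal_velocity.
have FC : \forall s \near (0 : R), peval F (c s) = cos (g%:R * (head 0 theta - ts s)).
  apply: filterS nU => s [Us ->].
  by rewrite -[parallel_map _ _]scale1r hU// expr1n mul1r.
(* Two derivatives of F along [c] are equated: the chain rule gives grad F . X, while F = cos(g
   (theta_1 - t)) gives g sin(g tau) t' with t' = X . N. *)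
have := is_derive_unique FC (is_derive_peval F dc) (is_derive_cosM _ _ Dts).
rewrite c0 ts0 -/tau => ->; rewrite (dotC N) T1E -!mulrA mulrA mulVf// mul1r.
by [].
Unshelve. all: by end_near. Qed.

End LocalStructure.

(** * Trigonometric forms and the restriction of F to a normal plane *)

Section PlaneFormula.
Context {R : realType}.

(* [qpow D A B k] is the pair (a, b) with (A + B sqrt(-D)) ^ k = a + b sqrt(-D);
   it keeps the trigonometric identities polynomial in the data. *)
Fixpoint qpow (D A B : R) (k : nat) : R * R :=
  if k is k'.+1 then
    (A * (qpow D A B k').1 - D * (B * (qpow D A B k').2),
     A * (qpow D A B k').2 + B * (qpow D A B k').1)
  else (1, 0).

(** E sqrt(-D) is a square root of -D E^2, so a factor of [B] can be moved into the radicand. *)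
Lemma qpow_scale (D E A B : R) (k : nat) :
  qpow D A (E * B) k =
  ((qpow (D * E ^+ 2) A B k).1, E * (qpow (D * E ^+ 2) A B k).2).
Proof. by elim: k => [|k /= ->] /=; congr (_, _); ring. Qed.

Lemma qpow_homog (c D A B : R) (k : nat) :
  qpow D (c * A) (c * B) k = (c ^+ k * (qpow D A B k).1, c ^+ k * (qpow D A B k).2).
Proof.
elim: k => [|k /= ->] /=; first by rewrite mulr1 mulr0.
by rewrite exprS; congr (_, _); ring.
Qed.

(** De Moivre's formula: for D = 1 the adjoined root is the imaginary unit. *)
Lemma qpow_cos_sin (u : R) (k : nat) :
  qpow 1 (cos u) (sin u) k = (cos (k%:R * u), sin (k%:R * u)).
Proof.
elim: k => [|k /= ->] /=; first by rewrite mul0r cos0 sin0.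
by rewrite -natr1 mulrDl [1 * u]mul1r cosD sinD; congr (_, _); ring.
Qed.

Lemma line_poly_qpow (m k : nat) (D A B : 'rV[R]_m -> R) :
  line_poly D -> line_poly A -> line_poly B ->
  line_poly (fun x => (qpow (D x) (A x) (B x) k).1) /\
  line_poly (fun x => (qpow (D x) (A x) (B x) k).2).
Proof.
move=> hD hA hB; elim: k => [|k [h1 h2]] /=; first by split; exact: line_polyC.
split; apply: line_polyD; try exact: line_polyM.
by apply: line_polyN; apply: line_polyM => //; exact: line_polyM.
Qed.

(** The real part of (e1 - i e2) (A + i B)^g, a binary form of degree [g]; for e1 = cos a, e2 = sin
    a it restricts to cos(a - g u) on the unit circle. *)
Definition trig_form (e1 e2 : R) (g : nat) (A B : R) : R :=
  e1 * (qpow 1 A B g).1 + e2 * (qpow 1 A B g).2.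

Lemma trig_form_homog (c e1 e2 A B : R) (g : nat) :
  trig_form e1 e2 g (c * A) (c * B) = c ^+ g * trig_form e1 e2 g A B.
Proof. by rewrite /trig_form qpow_homog /=; ring. Qed.

Lemma trig_form_cos_sin (a u : R) (g : nat) :
  trig_form (cos a) (sin a) g (cos u) (sin u) = cos (a - g%:R * u).
Proof. by rewrite /trig_form qpow_cos_sin cosB. Qed.

(** Both sides are polynomial in the pair (A, B), encoded as a row [y], so agreement near (1, 0)
    suffices. *)
Lemma plane_formula (m g : nat) (F : mpoly.mpoly m R) (p N : 'rV[R]_m) (e1 e2 : R) :
  nbhs (delta_mx 0 0 : 'rV[R]_2) [set y : 'rV[R]_2 |
    peval F (y 0 0 *: p + y 0 1 *: N) = trig_form e1 e2 g (y 0 0) (y 0 1)] ->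
  forall A B, peval F (A *: p + B *: N) = trig_form e1 e2 g A B.
Proof.
move=> h A B; apply/eqP; rewrite -subr_eq0; apply/eqP.
pose f (y : 'rV[R]_2) :=
  peval F (y 0 0 *: p + y 0 1 *: N) - trig_form e1 e2 g (y 0 0) (y 0 1).
have lf : line_poly f.
  apply: line_polyD; last first.
    have [h1 h2] := line_poly_qpow g (line_polyC 1) (line_poly_coord (0 : 'I_2))
      (line_poly_coord (1 : 'I_2)).
    by apply/line_polyN/line_polyD; apply: line_polyM => //; exact: line_polyC.
  apply: line_poly_peval => i.
  rewrite (_ : (fun _ => _) = fun y : 'rV[R]_2 => y 0 0 * p 0 i + y 0 1 * N 0 i).
    by apply: line_polyD; apply: line_polyM; (exact: line_polyC || exact: line_poly_coord).
  by apply/funext => y; rewrite !mxE.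
have nf : \forall y \near (delta_mx 0 0 : 'rV[R]_2), f y = 0.
  by apply: filterS h => y; rewrite /f => ->; rewrite subrr.
have := line_poly_eq0 lf nf (\row_i (if i == 0 then A else B)).
by rewrite /f !mxE.
Qed.

(** Near (1, 0) the first coordinate is positive, and homogeneity scales it to 1. *)
Lemma plane_formula_regular (m g : nat) (F : mpoly.mpoly m R) (p N : 'rV[R]_m)
    (e1 e2 : R) :
  F \is mpoly.ishomog1 g mpoly.mdeg ->
  (forall v, peval F (p + v *: N) = trig_form e1 e2 g 1 v) ->
  forall A B, peval F (A *: p + B *: N) = trig_form e1 e2 g A B.
Proof.
move=> hF h; apply: plane_formula.
have c0 : {for (delta_mx 0 0 : 'rV[R]_2), continuous (fun y : 'rV[R]_2 => y 0 0)}.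
  exact: coord_continuous.
have n0 : \forall y \near (delta_mx 0 0 : 'rV[R]_2), 0 < (y : 'rV[R]_2) 0 0.
  apply: (c0 [set x | 0 < x]); rewrite /= mxE; apply: open_nbhs_nbhs.
  by split; [exact: open_gt|exact: ltr01].
apply: filterS n0 => y y0 /=; have yn0 : y 0 0 != 0 by rewrite gt_eqF.
have -> : y 0 1 = y 0 0 * (y 0 1 / y 0 0) by rewrite mulrC divfK.
have := trig_form_homog (y 0 0) e1 e2 1 (y 0 1 / y 0 0) g; rewrite mulr1 /= => ->.
by rewrite -h -(peval_homog _ _ hF) scalerDr scalerA.
Qed.

Lemma plane_formula_circle (m g : nat) (F : mpoly.mpoly m R) (p N : 'rV[R]_m)
    (tau : R) :
  (\forall u \near (0 : R), forall r, 0 < r ->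
      peval F (r *: circle p N u) = r ^+ g * cos (g%:R * (tau - u))) ->
  forall A B, peval F (A *: p + B *: N) =
    trig_form (cos (g%:R * tau)) (sin (g%:R * tau)) g A B.
Proof.
move=> h; apply: plane_formula; set e : 'rV[R]_2 := delta_mx 0 0.
have e0 : e 0 0 = 1 by rewrite mxE.
have e1 : e 0 1 = 0 by rewrite mxE.
have c0 i : {for e, continuous (fun y : 'rV[R]_2 => y 0 i)}.
  exact: coord_continuous.
have n0 : \forall y \near e, 0 < (y : 'rV[R]_2) 0 0.
  apply: (c0 0 [set x | 0 < x]); rewrite /= e0; apply: open_nbhs_nbhs.
  by split; [exact: open_gt|exact: ltr01].
(* Polar coordinates in the half-plane A > 0: the angle is u = atan(B / A) and the radius is A / cos
   u. *)
have ca : {for e, continuous (fun y : 'rV[R]_2 => atan (y 0 1 * (y 0 0)^-1))}.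
  apply: continuous_comp; last exact: continuous_atan.
  apply: continuousM; first exact: c0.
  by apply: continuousV; [rewrite e0 oner_neq0|exact: c0].
have n1 := ca _ _; rewrite e1 mul0r atan0 in n1; move: {n1}(n1 _ h) => n1.
apply: filterS2 n0 n1 => y y0 /=; set u := atan _ => hu.
have cu : 0 < cos u by rewrite cos_gt0_pihalf// atan_gtNpi2 atan_ltpi2.
have y0E : y 0 0 = y 0 0 / cos u * cos u by rewrite divfK// gt_eqF.
have y1E : y 0 1 = y 0 0 / cos u * sin u.
  have : tan u = y 0 1 / y 0 0 by exact: atanK.
  rewrite /tan => tu; rewrite mulrAC -mulrA tu mulrC divfK//; exact: lt0r_neq0.
rewrite y1E {1 3}y0E trig_form_homog trig_form_cos_sin -mulrBr -hu ?divr_gt0//.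
by rewrite /circle scalerDr !scalerA.
Qed.

End PlaneFormula.

(** * Local identities extended to the whole space *)

Section GlobalIdentities.
Context {R : realType} {m : nat}.
Implicit Types (F : mpoly.mpoly m R) (V : set 'rV[R]_m).

Definition cartan_munzner_at (g : nat) F (p : 'rV[R]_m) : Prop :=
  exists tau N, [/\ orthonormal p N,
    gradient_map g F p = cos (g%:R * tau) *: p + sin (g%:R * tau) *: N &
    forall A B, peval F (A *: p + B *: N) =
      trig_form (cos (g%:R * tau)) (sin (g%:R * tau)) g A B].

(* The component of the gradient map normal to x, cleared of denominators. *)
Definition normal_part (g : nat) F (x : 'rV[R]_m) : 'rV[R]_m :=
  dot x x *: gradient_map g F x - peval F x *: x.

(** Where F = cos(g tau) on the sphere this is sin(g tau)^2, a polynomial substitute for the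
    sine. *)
Definition defect (g : nat) F (x : 'rV[R]_m) : R := dot x x ^+ g - peval F x ^+ 2.

Lemma line_poly_self F : line_poly (peval F).
Proof. exact: (line_poly_peval F (@line_poly_coord R m)). Qed.

Lemma line_poly_normsq : line_poly (fun x : 'rV[R]_m => dot x x).
Proof. exact: (line_poly_dot (@line_poly_coord R m) (@line_poly_coord R m)). Qed.

Lemma line_poly_gradient_map (g : nat) F (i : 'I_m) :
  line_poly (fun x => gradient_map g F x 0 i).
Proof.
rewrite (_ : (fun _ => _) = fun x => g%:R^-1 * peval (mderiv i F) x); last first.
  by apply/funext => x; rewrite !mxE.
by apply: line_polyM; [exact: line_polyC|exact: line_poly_self].
Qed.

Lemma line_poly_defect (g : nat) F : line_poly (defect g F).
Proof.
apply: line_polyD; first by apply: line_polyX; exact: line_poly_normsq.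
by apply: line_polyN; apply: line_polyX; exact: line_poly_self.
Qed.

(** The positive multiples of points of [V] contain a neighbourhood of each point of [V], so the
    identity principle applies to f1 - f2. *)
Lemma cone_identity V (f1 f2 : 'rV[R]_m -> R) :
  V !=set0 -> relatively_open (@sphere R m) V -> line_poly f1 -> line_poly f2 ->
  (forall p r, V p -> 0 < r -> f1 (r *: p) = f2 (r *: p)) -> f1 =1 f2.
Proof.
move=> [p Vp] oV h1 h2 h x; apply/eqP; rewrite -subr_eq0; apply/eqP.
apply: (@line_poly_eq0 R m (fun x => f1 x - f2 x) p).
  by apply: line_polyD => //; exact: line_polyN.
apply: filterS (cone_nbhs oV Vp) => _ [r [q r0 [Vq ->]]].
by rewrite h// subrr.
Qed.

Section Identities.
Context {d : nat}.
Local Notation g := d.+1.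
Context (F : mpoly.mpoly m R) (V : set 'rV[R]_m).
Context (hF : F \is mpoly.ishomog1 g mpoly.mdeg).
Context (V0 : V !=set0).
Context (oV : relatively_open (@sphere R m) V).
Context (hV : forall p, V p -> cartan_munzner_at g F p).

Lemma gradient_map_homog (r : R) (x : 'rV[R]_m) : r != 0 ->
  gradient_map g F (r *: x) = r ^+ d *: gradient_map g F x.
Proof. by move=> r0; rewrite /gradient_map (gradient_homog _ hF r0) !scalerA mulrC. Qed.

Lemma euler_gradient_map (x : 'rV[R]_m) : dot (gradient_map g F x) x = peval F x.
Proof. by rewrite dotZl (euler_homog _ hF) mulrA mulVf ?mul1r// pnatr_eq0. Qed.

(** The first Cartan-Münzner equation; over V it is cos^2 + sin^2 = 1, rescaled by homogeneity. *)
Lemma eikonal (x : 'rV[R]_m) :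
  dot (gradient_map g F x) (gradient_map g F x) = dot x x ^+ d.
Proof.
move: x; apply: (cone_identity V0 oV).
- by apply: line_poly_dot => i; exact: line_poly_gradient_map.
- by apply: line_polyX; exact: line_poly_normsq.
move=> p r /hV[tau [N [[pp NN pN] Phip _]]] r0.
rewrite gradient_map_homog ?gt_eqF// Phip !dotE pp NN (dotC N) pN.
apply: etrans (_ : (r * r) ^+ d *
  (cos (g%:R * tau) ^+ 2 + sin (g%:R * tau) ^+ 2) = _).
  by rewrite exprMn; ring.
by rewrite cos2Dsin2 !mulr1.
Qed.

Lemma normal_part_formula (s : R) (x : 'rV[R]_m) :
  peval F (x + s *: normal_part g F x) =
  peval F x * (qpow (defect g F x) 1 s g).1 +
  defect g F x * (qpow (defect g F x) 1 s g).2.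
Proof.
move: x; apply: (cone_identity V0 oV).
- apply: line_poly_peval => i.
  rewrite (_ : (fun _ => _) = fun x : 'rV[R]_m => x 0 i + s *
      (dot x x * gradient_map g F x 0 i + - (peval F x * x 0 i))); last first.
    by apply/funext => x; rewrite !mxE.
  apply: line_polyD; first exact: line_poly_coord.
  apply: line_polyM; first exact: line_polyC.
  apply: line_polyD; last apply: line_polyN; apply: line_polyM.
  + exact: line_poly_normsq.
  + exact: line_poly_gradient_map.
  + exact: line_poly_self.
  + exact: line_poly_coord.
- have [h1 h2] := line_poly_qpow g (line_poly_defect g F) (line_polyC 1) (line_polyC s).
  apply: line_polyD; apply: line_polyM => //; first exact: line_poly_self.
  exact: line_poly_defect.
move=> p r /hV[tau [N [[pp NN pN] Phip h]]] r0.
set c := cos (g%:R * tau) in Phip h *; set b := sin (g%:R * tau) in Phip h *.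
have cb : c ^+ 2 + b ^+ 2 = 1 by exact: cos2Dsin2.
have Fp : peval F p = c.
  have := h 1 0; rewrite scale1r scale0r addr0 => ->.
  by have := trig_form_cos_sin (g%:R * tau) 0 g; rewrite cos0 sin0 mulr0 subr0.
have FE : peval F (r *: p) = r ^+ g * c by rewrite (peval_homog _ _ hF) Fp.
(* [E] is a signed square root of the defect at r p, and the normal part there is r E N. Only E^2
   survives in the final formula, which is why that formula is polynomial. *)
pose E := r ^+ g * b.
have dE : defect g F (r *: p) = E ^+ 2.
  rewrite /defect FE dotZl dotZr pp mulr1 /E -expr2 -exprM mulnC exprM.
  rewrite !exprMn -[X in X - _]mulr1 -cb; ring.
have WE : r *: p + s *: normal_part g F (r *: p) = r *: (1 *: p + (E * s) *: N).
  rewrite /normal_part FE dotZl dotZr pp mulr1 gradient_map_homog ?gt_eqF// Phip.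
  by apply/rowP => i; rewrite !mxE /E exprS; ring.
rewrite WE (peval_homog _ _ hF) h /trig_form qpow_scale mul1r dE FE /E /=.
ring.
Qed.

End Identities.
End GlobalIdentities.

(** * Normal great circles through every point of the sphere *)

Section NormalCircles.
Context {R : realType} {m d : nat}.
Local Notation g := d.+1.
Context (F : mpoly.mpoly m R) (V : set 'rV[R]_m).
Context (hF : F \is mpoly.ishomog1 g mpoly.mdeg).
Context (V0 : V !=set0).
Context (oV : relatively_open (@sphere R m) V).
Context (hV : forall p, V p -> cartan_munzner_at g F p).

Lemma dot_normal_part (q : 'rV[R]_m) : dot q q = 1 ->
  dot (normal_part g F q) (normal_part g F q) = 1 - peval F q ^+ 2.
Proof.
move=> qq; rewrite /normal_part qq scale1r.
move: (gradient_map _ _ _) (eikonal hF V0 oV hV q) (euler_gradient_map hF q) => P eP hP.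
rewrite !dotE eP qq (dotC q) hP expr1n; ring.
Qed.

Lemma peval_sphere_le1 (q : 'rV[R]_m) : dot q q = 1 -> peval F q ^+ 2 <= 1.
Proof.
by move=> qq; rewrite -subr_ge0 -dot_normal_part// dot_ge0.
Qed.

(** The normal part at [q] has length sqrt(1 - F(q)^2), nonzero here, so it can be normalized to N.
    This N points so that the sine coefficient is the nonnegative root. *)
Lemma normal_circle_regular (q : 'rV[R]_m) : dot q q = 1 -> peval F q ^+ 2 != 1 ->
  exists2 N, orthonormal q N & forall u, peval F (circle q N u) =
    peval F q * cos (g%:R * u) + Num.sqrt (1 - peval F q ^+ 2) * sin (g%:R * u).
Proof.
move=> qq Fq; set b := Num.sqrt _.
have b2 : b ^+ 2 = 1 - peval F q ^+ 2.
  by rewrite sqr_sqrtr// subr_ge0 peval_sphere_le1.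
have b0 : b != 0 by rewrite -sqrf_eq0 b2 subr_eq0 eq_sym.
exists (b^-1 *: normal_part g F q).
  split=> //; first by rewrite dotZl dotZr dot_normal_part// -b2 expr2 mulKf// mulVf.
  rewrite dotZr /normal_part qq scale1r dotC.
  by rewrite dotDl dotNl dotZl (euler_gradient_map hF) qq mulr1 subrr mulr0.
move=> u; rewrite /circle.
have h v : peval F (q + v *: (b^-1 *: normal_part g F q)) =
    trig_form (peval F q) b g 1 v.
  rewrite scalerA (normal_part_formula hF V0 oV hV) /defect qq expr1n -b2.
  have E := qpow_scale 1 b 1 (v / b) g; rewrite mulrCA mulfV// mulr1 mul1r in E.
  by rewrite /trig_form E; cbn [fst snd]; ring.
rewrite (plane_formula_regular hF h) /trig_form qpow_cos_sin.
by [].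
Qed.

(** If F^2 = 1 held on an open piece of the sphere, then F^2 = |x|^(2g) everywhere, against the
    zeros of F on a normal circle. *)
Lemma dense_regular (q : 'rV[R]_m) : dot q q = 1 ->
  closure [set x | dot x x = 1 /\ peval F x ^+ 2 != 1] q.
Proof.
move=> qq B qB; apply: contrapT => h.
have h0 x : B x -> dot x x = 1 -> peval F x ^+ 2 = 1.
  move=> Bx xx; apply/eqP; apply: contrapT => /negP h1; apply: h; exists x.
  by split.
have oW : relatively_open (@sphere R m) (@sphere R m `&` interior B).
  by exists (interior B) => //; exact: open_interior.
have W0 : (@sphere R m `&` interior B) !=set0 by exists q.
have l1 : line_poly (fun x => peval F x ^+ 2) by apply: line_polyX; exact: line_poly_self.
have l2 : line_poly (fun x : 'rV[R]_m => dot x x ^+ g).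
  by apply: line_polyX; exact: line_poly_normsq.
have /(_ _)/= E : (fun x => peval F x ^+ 2) =1 (fun x => dot x x ^+ g).
  apply: (cone_identity W0 oW l1 l2) => p r [Sp /interior_subset Bp] r0.
  rewrite (peval_homog _ _ hF) exprMn (h0 p Bp Sp) mulr1 dotZl dotZr Sp mulr1 -expr2.
  by rewrite -!exprM mulnC.
have [p /hV[tau [N [on _ hAB]]]] := V0.
(* At this parameter g (tau - u) = pi / 2, so F vanishes. *)
have := E (circle p N (tau - pi / 2 / g%:R)).
rewrite circle_sphere// expr1n /circle hAB trig_form_cos_sin.
rewrite mulrBr opprB addrC subrK mulrC divfK ?pnatr_eq0// cos_pihalf expr0n /=.
by move=> /esym/eqP; rewrite oner_eq0.
Qed.

Lemma compact_sphere : compact (@sphere R m).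
Proof.
have cc : closed (@sphere R m).
  apply: (@closed_comp _ _ (fun x : 'rV[R]_m => dot x x) [set 1]); last exact: closed_eq.
  by move=> x _; apply: continuous_dot; exact: cvg_id.
have ck := @rV_compact R m (fun=> `[(-1), 1]%classic) (fun=> @segment_compact R _ _).
apply: (subclosed_compact cc ck) => x xx i /=.
rewrite in_itv /= -ler_norml -(@expr_le1 _ 2)// -normrX ger0_norm ?sqr_ge0//.
rewrite -xx /dot (bigD1 i)//= -expr2 lerDl; apply: sumr_ge0 => j _.
by rewrite -expr2 sqr_ge0.
Qed.

Lemma normal_circle (q : 'rV[R]_m) : dot q q = 1 ->
  exists2 N, orthonormal q N & forall u, peval F (circle q N u) =
    peval F q * cos (g%:R * u) + Num.sqrt (1 - peval F q ^+ 2) * sin (g%:R * u).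
Proof.
move=> qq.
(* The pairs (q, N) satisfying the conclusion form a compact set. Its projection to the sphere is
   therefore closed, and it contains the dense set of regular points. *)
pose K := [set z : 'rV[R]_m * 'rV[R]_m | orthonormal z.1 z.2 /\
  forall u, peval F (circle z.1 z.2 u) - (peval F z.1 * cos (g%:R * u) +
    Num.sqrt (1 - peval F z.1 ^+ 2) * sin (g%:R * u)) = 0].
have c1 : continuous (@fst 'rV[R]_m 'rV[R]_m) by move=> z; exact: cvg_fst.
have c2 : continuous (@snd 'rV[R]_m 'rV[R]_m) by move=> z; exact: cvg_snd.
have cF : continuous (fun z : 'rV[R]_m * 'rV[R]_m => peval F z.1).
  by move=> z; apply: (continuous_comp (c1 z)); exact: continuous_peval.
have cK : closed K.
  rewrite (_ : K = [set z | orthonormal z.1 z.2] `&` \bigcap_(u in setT) [set z |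
      peval F (circle z.1 z.2 u) - (peval F z.1 * cos (g%:R * u) +
      Num.sqrt (1 - peval F z.1 ^+ 2) * sin (g%:R * u)) = 0]); last first.
    by apply/seteqP; split=> z [h1 h2]; split=> // u *; exact: h2.
  apply: closedI.
    rewrite (_ : [set _ | _] = [set z | dot z.1 z.1 = 1] `&`
        ([set z | dot z.2 z.2 = 1] `&` [set z | dot z.1 z.2 = 0])); last first.
      by apply/seteqP; split=> z; [case|case=> ? []].
    apply: closedI; [|apply: closedI].
    - apply: (@closed_comp _ _ (fun z : 'rV[R]_m * 'rV[R]_m => dot z.1 z.1) [set 1]);
        last exact: closed_eq.
      by move=> x _; apply: continuous_dot; exact: c1.
    - apply: (@closed_comp _ _ (fun z : 'rV[R]_m * 'rV[R]_m => dot z.2 z.2) [set 1]);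
        last exact: closed_eq.
      by move=> x _; apply: continuous_dot; exact: c2.
    - apply: (@closed_comp _ _ (fun z : 'rV[R]_m * 'rV[R]_m => dot z.1 z.2) [set 0]);
        last exact: closed_eq.
      by move=> x _; apply: continuous_dot; [exact: c1|exact: c2].
  apply: closed_bigI => u _.
  apply: (@closed_comp _ _ (fun z : 'rV[R]_m * 'rV[R]_m =>
      peval F (circle z.1 z.2 u) - (peval F z.1 * cos (g%:R * u) +
      Num.sqrt (1 - peval F z.1 ^+ 2) * sin (g%:R * u))) [set 0]); last exact: closed_eq.
  move=> z _; apply: cvgB.
    apply: (@continuous_comp _ _ _ (fun z : 'rV[R]_m * 'rV[R]_m => circle z.1 z.2 u));
      last exact: continuous_peval.
    by apply: cvgD; apply: cvgZl_tmp; [exact: c1|exact: c2].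
  apply: cvgD; apply: cvgMr_tmp; first exact: cF.
  apply: (@continuous_comp _ _ _ (fun z : 'rV[R]_m * 'rV[R]_m => 1 - peval F z.1 ^+ 2)).
    by apply: cvgB; [exact: cvg_cst|apply: cvgM; exact: cF].
  exact: sqrt_continuous.
have kK : compact K.
  apply: (subclosed_compact cK (compact_setX compact_sphere compact_sphere)).
  by move=> z [[? ? _] _].
have kF : compact (fst @` K).
  by apply: continuous_compact => //; exact: continuous_subspaceT.
have clF : closed (fst @` K).
  by apply: compact_closed kF; exact: norm_hausdorff.
have sub : [set x | dot x x = 1 /\ peval F x ^+ 2 != 1] `<=` fst @` K.
  move=> x [xx Fx]; have [N on h] := normal_circle_regular xx Fx.
  by exists (x, N) => //; split=> // u; rewrite h subrr.
have [[q' N] [/= on h] <-] := clF _ (closure_subset sub (dense_regular qq)).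
by exists N => // u; apply/eqP; rewrite -subr_eq0 h.
Qed.

(* Along the great circle normal to the level sets at q the gradient map acts by
   rotation, since F restricts to cos(g(sigma - u)) and |Phi| = 1 there. *)
Lemma gradient_map_circle (q : 'rV[R]_m) (sigma : R) :
  dot q q = 1 -> peval F q = cos (g%:R * sigma) ->
  exists N, [/\ orthonormal q N,
    forall u, peval F (circle q N u) = cos (g%:R * (sigma - u)) &
    forall u, gradient_map g F (circle q N u) =
      circle q N (u + g%:R * (sigma - u))].
Proof.
move=> qq Fq; have [N0 on0 h0] := normal_circle qq.
(* The square root yields |sin(g sigma)|; when the sine is negative, reversing N restores the
   sign. *)
have [N on h] : exists2 N, orthonormal q N &
    forall u, peval F (circle q N u) = cos (g%:R * (sigma - u)).
  have sE : Num.sqrt (1 - peval F q ^+ 2) = `|sin (g%:R * sigma)|.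
    by rewrite Fq -sin2cos2 sqrtr_sqr.
  have [s0|s0] := lerP 0 (sin (g%:R * sigma)).
    exists N0 => // u; rewrite h0 sE ger0_norm// Fq mulrBr cosB; ring.
  exists (- N0).
    by case: on0 => h1 h2 h3; split; rewrite // ?dotNl dotNr ?opprK// h3 oppr0.
  move=> u; rewrite (_ : circle q (- N0) u = circle q N0 (- u)); last first.
    by rewrite /circle cosN sinN scaleNr scalerN.
  by rewrite h0 sE ltr0_norm// Fq mulrN cosN sinN mulrNN mulrBr cosB; ring.
exists N; split=> // u; set p := circle q N u; set N' := circle N (- q) u.
have on' : orthonormal p N' by exact: orthonormal_rot.
have [pp NN pN] := on'.
rewrite -circle_rot -/p -/N'; set th := g%:R * (sigma - u).
have hp : dot (gradient_map g F p) p = cos th by rewrite (euler_gradient_map hF) h.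
have hN : dot (gradient_map g F p) N' = sin th.
  rewrite dotZl.
  have d1 := is_derive_peval F (is_derive_circle q N u).
  have d2 : is_derive u (1 : R) (fun y => peval F (circle q N y)) (g%:R * sin th).
    rewrite (_ : (fun _ => _) = fun y => cos (g%:R * (sigma - id y))); last first.
      by apply/funext => y; rewrite h.
    by apply: (is_derive_eq (is_derive_cosM _ _ (is_derive_id _ _))); rewrite mulr1.
  by rewrite (is_derive_inj d1 d2) mulrA mulVf ?mul1r// pnatr_eq0.
(* The components cos th and sin th along [p] and [N'] already exhaust the unit length of the
   gradient map, so the squared distance to the rotated point is zero. *)
apply/eqP; rewrite -subr_eq0; apply/eqP/dot_eq0.
have := eikonal hF V0 oV hV p; rewrite pp expr1n.
move: (gradient_map _ _ _) hp hN => P hp hN eP.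
rewrite /circle; move: p N' pp NN pN hp hN {on'} => p N' pp NN pN hp hN.
rewrite !dotE eP pp NN (dotC p P) (dotC N' P) (dotC N' p) hp hN pN.
apply: etrans (_ : 1 - (cos th ^+ 2 + sin th ^+ 2) = _); first ring.
by rewrite cos2Dsin2 subrr.
Qed.

End NormalCircles.

(** * Images of level sets and the criterion for a diffeomorphism *)

Section LevelSets.
Context {R : realType}.

Lemma isoparametric_circle (n g : nat) (F : mpoly.mpoly n.+2 R) (q : 'rV[R]_n.+2)
    (sigma : R) :
  (0 < g)%N -> isoparametric_polynomial g F ->
  dot q q = 1 -> peval F q = cos (g%:R * sigma) ->
  exists N, [/\ orthonormal q N,
    forall u, peval F (circle q N u) = cos (g%:R * (sigma - u)) &
    forall u, gradient_map g F (circle q N u) =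
      circle q N (u + g%:R * (sigma - u))].
Proof.
case: g => // d _ [M [xi [theta [sz [_ _ oM _ _] iF]]]].
have [V [V0 oV hV]] : exists V, [/\ V !=set0, relatively_open (@sphere R n.+2) V &
    forall p, V p -> cartan_munzner_at d.+1 F p].
  have := local_structure oM iF; rewrite sz => /(_ isT)[V [V0 oV hV]].
  exists V; split => // p /hV[tau [N [on Phip hu]]].
  by exists tau, N; split => //; exact: plane_formula_circle hu.
have hF : F \is mpoly.ishomog1 d.+1 mpoly.mdeg by case: iF; rewrite sz.
exact: (gradient_map_circle hF V0 oV hV).
Qed.

Lemma circle0 (m : nat) (q N : 'rV[R]_m) : circle q N 0 = q.
Proof. by rewrite /circle cos0 sin0 scale1r scale0r addr0. Qed.

Lemma image_level_set (n g : nat) (F : mpoly.mpoly n.+2 R) (tau : R) :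
  (0 < g)%N -> isoparametric_polynomial g F ->
  gradient_map g F @` level_set F (cos (g%:R * tau)) =
  level_set F (cos (g%:R * (1 - g%:R) * tau)).
Proof.
move=> g0 hF; apply/seteqP; split.
- move=> _ [p [pp Fp] <-].
  have [N [on hc hPhi]] := isoparametric_circle g0 hF pp Fp.
  have -> : gradient_map g F p = circle p N (g%:R * tau).
    by rewrite -{1}(circle0 p N) hPhi subr0 add0r.
  split; first exact: circle_sphere.
  by rewrite hc; congr cos; ring.
- move=> q [qq]; rewrite -mulrA => Fq.
  have [N [on hc hPhi]] := isoparametric_circle g0 hF qq Fq.
  (* With sigma = (1 - g) tau, the equation u + g (sigma - u) = 0 for a preimage of [q] on its
     normal circle is solved by u = - g tau. *)
  exists (circle q N (- (g%:R * tau))).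
    split; first exact: circle_sphere.
    by rewrite hc; congr cos; ring.
  rewrite hPhi -[RHS](circle0 q N); congr circle; ring.
Qed.

Lemma cosMnpi (k : nat) : cos (k%:R * pi) = 1 :> R \/ cos (k%:R * pi) = -1 :> R.
Proof.
elim: k => [|k IH]; first by rewrite mul0r cos0; left.
by rewrite -natr1 mulrDl mul1r cosDpi; case: IH => ->; [right|left; rewrite opprK].
Qed.

(** With k the integer part of x / pi, the remainder x - k pi lies in [0, pi), where the sine
    vanishes only at 0. *)
Lemma sin_eq0_pi (x : R) : 0 <= x -> sin x = 0 -> exists k : nat, x = k%:R * pi.
Proof.
move=> x0 sx.
have px : 0 <= x / pi by rewrite divr_ge0// pi_ge0.
have /andP[h1 h2] := truncn_itv px.
set k := Num.truncn (x / pi) in h1 h2; exists k.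
have pi0 : 0 < pi :> R := pi_gt0 R.
have s0 : sin (x - k%:R * pi) = 0.
  have kp : sin (k%:R * pi) = 0 :> R.
    elim: (k) => [|j IH]; first by rewrite mul0r sin0.
    by rewrite -natr1 mulrDl mul1r sinDpi IH oppr0.
  by rewrite sinB sx kp mul0r mulr0 subrr.
apply/eqP; rewrite -subr_eq0; apply: contraT => xk.
have : 0 < sin (x - k%:R * pi).
  apply: sin_gt0_pi; rewrite lt_neqAle eq_sym xk subr_ge0 /=.
  rewrite -ler_pdivlMr// h1 /= ltrBlDr -[X in X + _]mul1r -mulrDl.
  by rewrite -ltr_pdivrMr// addrC natr1.
by rewrite s0 ltxx.
Qed.

Lemma sin_neq0_cos_itv (x : R) : sin x != 0 -> -1 < cos x < 1.
Proof.
move=> sx; rewrite !lt_neqAle cos_geN1 cos_le1 !andbT; apply/andP; split;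
  apply: contra_neq sx => cx; apply: cos1sin0.
- by rewrite -cx normrN normr1.
- by rewrite cx normr1.
Qed.

Lemma poly_map_lincomb (m g : nat) (F : mpoly.mpoly m R) (a b : R) :
  (fun q => a *: q + b *: gradient_map g F q) =
  poly_map (fun i => a *: mpolyX R (mnm1 i) + (b / g%:R) *: mderiv i F).
Proof.
apply/funext => q; apply/rowP => i; rewrite !mxE pevalE /peval !mevalZ mevalXU.
by rewrite mulrA.
Qed.

(** The second hypothesis says that the polynomial map q -> a q + b Phi(q) is a left inverse of Phi
    on [A], giving both injectivity and a smooth inverse. *)
Lemma diffeo_gradient_map (m g : nat) (F : mpoly.mpoly m R) (A : set 'rV[R]_m)
    (a b : R) :
  gradient_map g F @` A = A ->
  (forall p, A p -> a *: gradient_map g F p +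
                    b *: gradient_map g F (gradient_map g F p) = p) ->
  diffeo A A (gradient_map g F).
Proof.
move=> im hK; split.
- split.
  + by move=> p Ap /=; rewrite -im; exists p.
  + move=> x y /set_mem Ax /set_mem Ay xy.
    by rewrite -(hK x Ax) -(hK y Ay) xy.
  + by move=> y; rewrite -{1}im.
- rewrite (_ : gradient_map g F = fun q => 0 *: q + 1 *: gradient_map g F q).
    by rewrite poly_map_lincomb; exact: smooth_poly_map.
  by apply/funext => q; rewrite scale0r add0r scale1r.
- exists (fun q => a *: q + b *: gradient_map g F q) => //.
  by rewrite poly_map_lincomb; exact: smooth_poly_map.
Qed.

End LevelSets.
Unset Implicit Arguments.

Theorem theorem1p1 (R : realType) (n g : nat) (F : mpoly.mpoly n.+2 R)
    (hg : (2 <= g)%N) (hF : isoparametric_polynomial g F) :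
  let Phi := gradient_map g F in
  let M := level_set F in
  [/\ forall tau : R,
        Phi @` M (cos (g%:R * tau)) = M (cos (g%:R * (1 - g%:R) * tau)),
      (Phi @` M 1 = M 1 \/ Phi @` M 1 = M (-1)) /\
      (Phi @` M (-1) = M 1 \/ Phi @` M (-1) = M (-1)),
      forall s : R, exceptional_values g s ->
        Phi @` M s = M 1 \/ Phi @` M s = M (-1),
      forall s : R, -1 < s < 1 -> ~ exceptional_values g s ->
        exists2 s' : R, -1 < s' < 1 & Phi @` M s = M s' &
      exists s : R,
        [/\ -1 < s < 1, Phi @` M s = M s & diffeo (M s) (M s) Phi]].
Proof.
have g0 : (0 < g)%N by exact: ltnW.
have gR : (g%:R : R) != 0 by rewrite pnatr_eq0 -lt0n.
have g1 : (g%:R - 1 : R) = g.-1%:R by rewrite -subn1 natrB.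
have g1R : (g%:R - 1 : R) != 0 by rewrite g1 pnatr_eq0; case: (g) hg => [|[]].
move=> Phi M.
have im tau : Phi @` M (cos (g%:R * tau)) = M (cos (g%:R * (1 - g%:R) * tau)).
  exact: image_level_set.
(* The main equality in the angle a = g tau; evenness of the cosine turns 1 - g into g - 1. *)
have imc a : Phi @` M (cos a) = M (cos ((g%:R - 1) * a)).
  rewrite -[a](divfK gR) [a / _ * _]mulrC im; congr (M _).
  by rewrite -cosN; congr cos; ring.
have focal (k : nat) : M (cos (k%:R * pi)) = M 1 \/ M (cos (k%:R * pi)) = M (-1).
  by have [->|->] := @cosMnpi R k; [left|right].
split => //.
- split; first by left; rewrite -cos0 imc mulr0.
  by have := focal g.-1; rewrite -g1 -imc cospi.
- move=> s [k _ ->]; rewrite imc mulrC divfK//; exact: focal.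
- move=> s /andP[s1 s2] sD.
  have sI : s \in `[-1, 1] by rewrite in_itv /= (ltW s1) (ltW s2).
  pose a := acos s; have as_ : cos a = s by exact: acosK.
  have a0 : 0 < a by rewrite acos_gt0// (ltW s1).
  have api : a < pi by rewrite acos_ltpi// s1 (ltW s2).
  exists (cos ((g%:R - 1) * a)); last by rewrite -as_ imc.
  (* A focal image would force (g - 1) a = k pi; then 0 < a < pi gives 1 <= k < g - 1, so [s] would
     be exceptional. *)
  apply: sin_neq0_cos_itv; apply/eqP => s0; apply: sD.
  have g1p : 0 < g%:R - 1 :> R by rewrite g1 ltr0n; case: (g) hg => [|[]].
  have [k kE] := sin_eq0_pi (ltW (mulr_gt0 g1p a0)) s0.
  have aE : a = k%:R * pi / (g%:R - 1) by rewrite -kE mulrC mulKf.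
  exists k; last by rewrite -as_ aE.
  have pi0 : 0 < pi :> R := pi_gt0 R.
  apply/andP; split.
    by rewrite -(@ltr0n R) -(pmulr_lgt0 _ pi0) -kE mulr_gt0.
  by rewrite -(@ltr_nat R) -g1 -(ltr_pM2r pi0) -kE ltr_pM2l.
- have fixed a : sin a != 0 -> cos ((g%:R - 1) * a) = cos a ->
      (exists a' b', forall p, M (cos a) p -> a' *: Phi p + b' *: Phi (Phi p) = p) ->
      exists s : R, [/\ -1 < s < 1, Phi @` M s = M s & diffeo (M s) (M s) Phi].
    move=> sa ca [a' [b' hK]]; exists (cos a).
    have ima : Phi @` M (cos a) = M (cos a) by rewrite imc ca.
    by split=> //; [exact: sin_neq0_cos_itv|exact: diffeo_gradient_map hK].
  (* On M (cos a) the maps Phi and Phi o Phi rotate p along its normal circle by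
     the angles a and 2 a - g a. *)
  have rot a p : M (cos a) p -> exists N,
      [/\ p = circle p N 0, Phi p = circle p N a &
        Phi (Phi p) = circle p N (a + a - g%:R * a)].
    move=> [pp Fp]; rewrite -[a](divfK gR) [a / _ * _]mulrC in Fp.
    have [N [_ _ hPhi]] := isoparametric_circle g0 hF pp Fp.
    have E : Phi p = circle p N a.
      rewrite -{1}(circle0 p N) /Phi hPhi; congr circle.
      by rewrite subr0 add0r mulrC divfK.
    exists N; split=> //; first by rewrite circle0.
    rewrite {1}E /Phi hPhi; congr circle.
    by rewrite mulrBr [g%:R * (a / _)]mulrC divfK// addrA.
  have [g2|g3] := eqVneq g 2%N.
    (* For g = 2 the rotation angle 2 a - g a of Phi o Phi is zero, so Phi is its own inverse. *)
    apply: (fixed (pi / 2)).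
    + by rewrite sin_pihalf oner_neq0.
    + by rewrite g2 (_ : 2%:R - 1 = 1 :> R) ?mul1r//; ring.
    + exists 0, 1 => p /rot[N [pE _ ->]].
      rewrite scale0r add0r scale1r [RHS]pE; congr circle.
      by rewrite g2; field.
  have pi0 : 0 < pi :> R := pi_gt0 R.
  have g2 : (2 < g)%N by rewrite ltn_neqAle eq_sym g3.
  (* This angle satisfies (g - 1) a = 2 pi - a, so the level is preserved; g > 2 gives a < pi, so
     the level is regular. *)
  pose a : R := pi *+ 2 / g%:R.
  have ga : g%:R * a = pi *+ 2 by rewrite mulrC divfK.
  apply: (fixed a).
  + rewrite gt_eqF//; apply: sin_gt0_pi; apply/andP; split.
      by rewrite divr_gt0 ?ltr0n// pmulrn_lgt0.
    by rewrite ltr_pdivrMr ?ltr0n// -[pi *+ 2]mulr_natr ltr_pM2l// ltr_nat.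
  + rewrite mulrBl mul1r ga addrC.
    by rewrite cosD2pi cosN.
  (* Modulo 2 pi, Phi o Phi now rotates by 2 a. On a circle the points at angles 0 and 2 a add up to
     2 cos a times the point at angle a, which recovers [p]. *)
  + exists (cos a *+ 2), (-1) => p /rot[N [pE -> ->]].
    rewrite [RHS]pE ga /circle cos0 sin0.
    rewrite (cosB (a + a)) (sinB (a + a)) cos2pi sin2pi !mulr0 !mulr1 addr0 subr0.
    rewrite cosD sinD; apply/rowP => i; rewrite !mxE.
    apply: etrans (_ : (cos a ^+ 2 + sin a ^+ 2) * p 0 i = _); first by ring.
    by rewrite cos2Dsin2; ring.
Qed.
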